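(* Let $q$ be a prime power, $\xi$ a primitive element of $\mathbb{F}_q$, $\ell$ a positive divisor of $q-1$, $r$ a positive integer, and $a_0,\ldots,a_{\ell-1}\in\mathbb{F}_q^*$ all lying in the same cyclotomic coset $C_j$ of index $\ell$. Suppose $f(x)\in\mathbb{F}_q[x]$ is a permutation polynomial of $\mathbb{F}_q$ with $f(0)=0$ and $f(x)=a_ix^r$ for all $x\in C_i$, $i=0,\ldots,\ell-1$. Then $$Crk(f)\ge q-\max\big\{3q^{1/2},\ \mathcal{L}(f),\ \mathcal{I}(f)\big\}.$$
   Context: Cyclotomic cosets of index $\ell$: $C_0=\{\xi^{k\ell}: k=0,\ldots,(q-1)/\ell-1\}$ (the subgroup of nonzero $\ell$-th powers) and $C_i=\xi^iC_0$ for $i=0,\ldots,\ell-1$. Let $x^{q-2}$ denote the map sending $0\mapsto0$ and $x\mapsto x^{-1}$ for $x\ne0$. The Carlitz rank $Crk(f)$ of a permutation polynomial $f$ of $\mathbb{F}_q$ is the smallest integer $n\ge0$ such that $f$ coincides on $\mathbb{F}_q$ with $P_n(x)=(\ldots((c_0x+c_1)^{q-2}+c_2)^{q-2}\ldots+c_n)^{q-2}+c_{n+1}$ for some $c_i\in\mathbb{F}_q$ with $c_i\neq0$ for $i=0,2,\ldots,n$. Linearity: $\mathcal{L}(f)=\max_{a\in\mathbb{F}_q^*}|\{c\in\mathbb{F}_q: f(c)=ac\}|$. Invertibility: $\mathcal{I}(f)=\max_{c\in\mathbb{F}_q^*}|\{x\in\mathbb{F}_q^*: f(x)=c/x\}|$.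 *)

(* Defs.v *)
From HB Require Import structures.
From mathcomp Require Import all_boot all_order all_algebra all_fingroup.
From mathcomp Require Import ring.

Set Implicit Arguments.
Unset Strict Implicit.
Unset Printing Implicit Defensive.

Import Order.TTheory GRing.Theory Num.Theory.
Local Open Scope ring_scope.

Lemma carlitz_transposition (K : fieldType) (a x : K) :
  a != 0 -> x != 0 -> x != a ->
  - (a * a) * (((x - a)^-1 + a^-1)^-1 - a)^-1 = x.
Proof.
move=> a0 x0; rewrite -subr_eq0 => xa0.
have aa0 : - (a * a) != 0 by rewrite oppr_eq0 mulf_neq0.
have -> : (x - a)^-1 + a^-1 = x / (a * (x - a)) by field; apply/andP.
have -> : (x / (a * (x - a)))^-1 - a = - (a * a) / x.
  by field; apply/and3P; split.
by field; apply/andP.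
Qed.

Section Carlitz.
Variable F : finFieldType.
Implicit Types (f : {poly F}) (xi : F) (c : nat -> F) (g h : F -> F).

Definition cyclotomic_coset0 xi (l : nat) : {set F} :=
  [set xi ^+ (k * l) | k : 'I_(#|F|.-1 %/ l)].

Definition cyclotomic_coset xi (l i : nat) : {set F} :=
  [set xi ^+ i * y | y in cyclotomic_coset0 xi l].

Definition perm_poly f : Prop := bijective (horner f).

(* The map x^{q-2} (0 |-> 0 and x |-> 1/x otherwise) is GRing.inv, since      *)
(* 0^-1 = 0; for q = 2 this differs from evaluating the monomial 'X^0.        *)
Fixpoint carlitz_map c (n : nat) (x : F) : F :=
  if n is m.+1 then (carlitz_map c m x)^-1 + c n.+1 else c 0%N * x + c 1%N.

Definition carlitz_rep f (n : nat) : bool :=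
  [exists c : n.+2.-tuple F,
    [&& c`_0 != 0,
        [forall i : 'I_n.+1, (2 <= i)%N ==> (c`_i != 0)]
      & [forall x, f.[x] == carlitz_map (nth 0 c) n x]]].

Definition linearity f : nat :=
  \max_(a : F | a != 0) #|[set c : F | f.[c] == a * c]%R|.

Definition invertibility f : nat :=
  \max_(c : F | c != 0) #|[set x : F | (x != 0) && (f.[x] == c / x)]%R|.

(* Every permutation of F is a carlitz_map (the composite in                  *)
(* carlitz_transposition is the transposition (0 a)), so the minimum defining *)
(* the Carlitz rank exists.                                                   *)

Definition coef_ok c (n : nat) :=
  c 0%N != 0 /\ forall i : nat, (2 <= i <= n)%N -> c i != 0.

Definition representable g := exists c (n : nat), coef_ok c n /\ g =1 carlitz_map c n.

Definition preserves_repr h := forall g, representable g -> representable (h \o g).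

Lemma eq_carlitz_map c c' n :
  (forall i, (i <= n.+1)%N -> c i = c' i) ->
  carlitz_map c n =1 carlitz_map c' n.
Proof.
elim: n => [|n IHn] eqc x /=; first by rewrite !eqc.
by rewrite IHn ?eqc // => i le_i; rewrite eqc // (leq_trans le_i).
Qed.

Definition upd_coef c k (b : F) i := if i == k then b else c i.

Lemma carlitz_map_upd c n m b : (n.+1 < m)%N ->
  carlitz_map (upd_coef c m b) n =1 carlitz_map c n.
Proof.
move=> lt_m; apply: eq_carlitz_map => i le_i; rewrite /upd_coef.
by case: eqP => // ei; rewrite ei leqNgt lt_m in le_i.
Qed.

Lemma coef_ok_upd c n m b : coef_ok c n -> (n < m)%N -> coef_ok (upd_coef c m b) n.
Proof.
move=> [c0 cn] lt_m; split=> [|i /andP[i2 le_i]]; rewrite /upd_coef ifN.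
- by [].
- by rewrite neq_ltn (leq_ltn_trans _ lt_m).
- by apply: cn; rewrite i2.
- by rewrite neq_ltn (leq_ltn_trans le_i lt_m).
Qed.

Lemma eq_preserves h h' : h =1 h' -> preserves_repr h -> preserves_repr h'.
Proof.
move=> eqh Hh g /Hh [c [n [okc eqg]]]; exists c, n; split=> // x.
by rewrite -eqg /= eqh.
Qed.

Lemma preserves_comp h h' :
  preserves_repr h -> preserves_repr h' -> preserves_repr (h \o h').
Proof. by move=> Hh Hh' g /Hh'/Hh. Qed.

Lemma preserves_add b : preserves_repr (fun y => y + b).
Proof.
move=> g [c [n [okc eqg]]]; exists (upd_coef c n.+1 (c n.+1 + b)), n; split.
  exact: coef_ok_upd.
move=> x; rewrite /= eqg; case: n {okc eqg} => [|n] /=.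
  by rewrite /upd_coef /= addrA.
by rewrite carlitz_map_upd // /upd_coef eqxx addrA.
Qed.

Lemma scale_coef n : forall c (a : F), a != 0 -> exists c',
  (forall i, (c' i == 0) = (c i == 0)) /\
  forall x, a * carlitz_map c n x = carlitz_map c' n x.
Proof.
elim: n => [|n IHn] c a a0.
  exists (fun i => a * c i); split=> [i|x] /=; last by rewrite mulrDr mulrA.
  by rewrite mulf_eq0 (negPf a0).
have /(IHn c) [c' [c'0 eqc']] : a^-1 != 0 by rewrite invr_eq0.
exists (upd_coef c' n.+2 (a * c n.+2)); split=> [i|x] /=.
  rewrite /upd_coef; have [->|_] := eqVneq i n.+2; last exact: c'0.
  by rewrite mulf_eq0 (negPf a0).
by rewrite carlitz_map_upd // -eqc' /upd_coef eqxx mulrDr invfM invrK.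
Qed.

Lemma preserves_mul (a : F) : a != 0 -> preserves_repr (fun y => a * y).
Proof.
move=> a0 g [c [n [[c0 cn] eqg]]]; have [c' [c'0 eqc']] := scale_coef n c a0.
exists c', n; split; last by move=> x; rewrite /= eqg eqc'.
by split=> [|i le_i]; rewrite c'0 //; apply: cn.
Qed.

Lemma preserves_inv : preserves_repr (@GRing.inv F).
Proof.
move=> g [c [n [okc eqg]]].
have [/andP[n_gt0 /eqP cn0]|] := boolP ((0 < n)%N && (c n.+1 == 0)).
  case: n n_gt0 cn0 okc eqg => // n _ cn0 [c0 cn] eqg; exists c, n; split.
    split=> // i /andP[i2 le_i]; apply: cn; rewrite i2.
    exact: leq_trans le_i _.
  by move=> x; rewrite /= eqg /= cn0 addr0 invrK.
rewrite negb_and -leqNgt leqn0 => ncn.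
exists (upd_coef c n.+2 0), n.+1; split; last first.
  by move=> x /=; rewrite eqg carlitz_map_upd // /upd_coef eqxx addr0.
have [c0 cn] := okc; split=> [|i /andP[i2]]; first by rewrite /upd_coef.
rewrite leq_eqVlt => /predU1P[i_n | lt_i]; rewrite /upd_coef ifN ?neq_ltn.
- by case/orP: ncn => [/eqP n0|]; [rewrite i_n n0 in i2 | rewrite i_n].
- by rewrite i_n leqnn.
- by apply: cn; rewrite i2.
- by rewrite (ltn_trans lt_i).
Qed.

Lemma preserves_tperm0 (a : F) : a != 0 -> preserves_repr (tperm 0 a).
Proof.
move=> a0; have a2 : - (a * a) != 0 by rewrite oppr_eq0 mulf_neq0.
pose H := preserves_comp.
have := H _ _ (preserves_mul a2) (H _ _ preserves_inv (H _ _ (preserves_add (- a))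
  (H _ _ preserves_inv (H _ _ (preserves_add a^-1)
  (H _ _ preserves_inv (preserves_add (- a))))))).
apply: eq_preserves => x /=; case: tpermP => [-> | -> | /eqP x0 /eqP xa].
- by rewrite sub0r invrN addNr invr0 sub0r invrN mulrNN -mulrA divff // mulr1.
- by rewrite subrr invr0 add0r invrK subrr invr0 mulr0.
exact: carlitz_transposition.
Qed.

Lemma preserves_tperm (a b : F) : preserves_repr (tperm a b).
Proof.
have [->|neq_ab] := eqVneq a b.
  by rewrite tperm1; apply: (eq_preserves (h := id)) => // x; rewrite perm1.
have ba : b - a != 0 by rewrite subr_eq0 eq_sym.
have := preserves_comp (preserves_add a)
  (preserves_comp (preserves_tperm0 ba) (preserves_add (- a))).
apply: eq_preserves => x /=; case: (tpermP a b x) => [-> | -> | /eqP xa /eqP xb].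
- by rewrite subrr tpermL subrK.
- by rewrite tpermR add0r.
by rewrite tpermD ?subrK // eq_sym ?subr_eq0 // (inj_eq (addIr _)).
Qed.

Lemma preserves_perm (s : {perm F}) : preserves_repr s.
Proof.
have [ts -> _] := prod_tpermP s.
elim: ts => [|t ts IHts].
  by rewrite big_nil; apply: (eq_preserves (h := id)) => // x; rewrite perm1.
rewrite big_cons.
apply: eq_preserves (preserves_comp IHts (preserves_tperm t.1 t.2)) => x.
by rewrite permM.
Qed.

Lemma carlitz_rep_exists f : perm_poly f -> exists n, carlitz_rep f n.
Proof.
move=> /bij_inj f_inj.
have repr_id : representable id.
  exists (fun i => (i == 0)%:R), 0%N; split; last by move=> x /=; rewrite mul1r addr0.
  by split=> [|i /andP[/leq_trans le /le]]; rewrite ?oner_eq0.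
have [c [n [[c0 cn] eqf]]] := @preserves_perm (perm f_inj) id repr_id.
exists n; apply/existsP.
have szc : size (mkseq c n.+2) == n.+2 by rewrite size_mkseq.
have nth_c i : (i <= n.+1)%N -> nth 0 (Tuple szc) i = c i.
  by move=> le_i; exact: (@nth_mkseq F 0 c n.+2 i le_i).
exists (Tuple szc); apply/and3P; split; first by rewrite nth_c.
  apply/forallP=> i; apply/implyP=> i2; have le_i := ltn_ord i.
  by rewrite nth_c 1?ltnW //; apply: cn; rewrite i2.
apply/forallP=> x; apply/eqP; transitivity (carlitz_map c n x).
  by rewrite -eqf /comp permE.
by apply: eq_carlitz_map => i /nth_c.
Qed.

Definition Crk f (f_perm : perm_poly f) : nat :=
  ex_minn (carlitz_rep_exists f_perm).

End Carlitz.

(* Main.v *)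
(** A map [P_n] agrees with a Moebius map [R x = (A x + B) / (C x + D)] outside
    at most [n] points, so [f] agrees with some [R] on at least [q - Crk f]
    points.  If [R x = a x] or [R x = c / x], this is bounded by the linearity
    or the invertibility of [f].  Otherwise let [G] be the set of nonzero points
    of agreement and write [q - 1 = l m].
    - If [l <= sqrt q]: for [t <> 1] with [t ^ m = 1], the points [x] and [t x]
      lie in the same coset, so if both are in [G] then [R (t x) = t ^ r R x],
      a quadratic equation in [x].  Hence [G] has few pairs in a common coset,
      and Cauchy-Schwarz over the [l] cosets gives [#|G| <= 2 sqrt q].
    - If [l > sqrt q], then [m < sqrt q].  As all the [a_i] lie in one coset,
      [(A x + B) ^ m = c x ^ (r m) (C x + D) ^ m] on [G].  Stepanov's method
      applied to this equation gives [#|G| < 2 sqrt q + m - 1]. *)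

Require Import Defs.
From mathcomp Require Import all_boot all_order all_algebra all_field.
From mathcomp Require Import ring lra zify.

Set Implicit Arguments.
Unset Strict Implicit.
Unset Printing Implicit Defensive.

Import Order.TTheory GRing.Theory Num.Theory.
Local Open Scope ring_scope.

(** * Counting tools: Cauchy-Schwarz, linear dependence, roots with multiplicity *)

Lemma leq_sqr_sum (I : finType) (P : pred I) (n : I -> nat) :
  ((\sum_(i | P i) n i) ^ 2 <= #|P| * \sum_(i | P i) n i ^ 2)%N.
Proof.
rewrite -(leq_pmul2l (ltn0Sn 1)) expnS expn1 big_distrl /=.
under eq_bigr do rewrite big_distrr /=.
rewrite big_distrr /=.
apply: (@leq_trans (\sum_(i | P i) \sum_(j | P j) (n i ^ 2 + n j ^ 2))%N).
  apply: leq_sum => i _; rewrite big_distrr /=.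
  by apply: leq_sum => j _; apply: nat_Cauchy.
under eq_bigr do rewrite big_split /= sum_nat_const.
by rewrite big_split /= sum_nat_const -big_distrr /= addnn mul2n.
Qed.

(** Pigeonhole: [F^I] has more elements than [F^J], so two vectors [v] and [w] have the same image,
    and [v - w] is the relation. *)
Lemma exists_lin_dep (F : finFieldType) (I J : finType) (A : I -> J -> F) :
  (#|J| < #|I|)%N ->
  exists v : I -> F,
    (exists i, v i != 0) /\ forall j, \sum_i v i * A i j = 0.
Proof.
move=> ltJI.
pose phi (v : {ffun I -> F}) : {ffun J -> F} := [ffun j => \sum_i v i * A i j].
have /injectivePn [v [w neq_vw eq_phi]] : ~~ injectiveb phi.
  apply/negP => /injectiveP /leq_card.
  rewrite !card_ffun leq_exp2l ?card_finNzRing_gt1 // => leIJ.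
  by move: (leq_trans ltJI leIJ); rewrite ltnn.
exists (fun i => v i - w i); split.
  apply/existsP; apply: contraNT neq_vw => /existsPn eq0.
  by apply/eqP/ffunP => i; apply/eqP; rewrite -subr_eq0; apply/negPn/eq0.
move=> j; under eq_bigr do rewrite mulrBl.
rewrite sumrB; apply/eqP; rewrite subr_eq0; apply/eqP.
by move/ffunP/(_ j): eq_phi; rewrite !ffunE.
Qed.

(** Powers of distinct [X - x] are coprime, so their product, of degree [#|T| * M], divides [p]. *)
Lemma leq_mul_card_roots (F : finFieldType) (p : {poly F}) (M : nat) (T : {set F}) :
  p != 0 -> (forall x, x \in T -> ('X - x%:P) ^+ M %| p) ->
  (#|T| * M < size p)%N.
Proof.
move=> p0 dvdp.
have sz s : size (\prod_(x <- s) ('X - x%:P) ^+ M : {poly F}) = (size s * M).+1.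
  elim: s => [|x s IHs]; first by rewrite big_nil size_poly1.
  rewrite big_cons size_monicM ?monic_exp ?monicXsubC -?size_poly_eq0 ?IHs //.
  by rewrite size_exp_XsubC mulSn /= addnS.
have dvdM s : uniq s -> {subset s <= T} -> \prod_(x <- s) ('X - x%:P) ^+ M %| p.
  elim: s => [|x s IHs] /=; first by rewrite big_nil dvd1p.
  case/andP=> xs us sT; rewrite big_cons Gauss_dvdp.
    rewrite dvdp ?sT ?mem_head // IHs // => y ys.
    by rewrite sT // inE ys orbT.
  rewrite coprimep_expl // coprimep_sym coprimep_XsubC.
  rewrite rootE horner_prod prodf_seq_neq0; apply/allP => y ys /=.
  rewrite !hornerE expf_neq0 // subr_eq0.
  by apply: contraNneq xs => ->.
rewrite cardE -sz dvdp_leq // dvdM ?enum_uniq // => x.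
by rewrite mem_enum.
Qed.

(** * Moebius maps approximating Carlitz maps *)

Section Moebius.
Variable F : finFieldType.
Implicit Types (g : F -> F) (A B C D : F).

Definition moebius_agree g A B C D : {set F} :=
  [set x | (C * x + D != 0) && (g x == (A * x + B) / (C * x + D))].

(** Where [P_n] agrees with [R], the next map agrees with [1 / R + c], again Moebius, with
    determinant of opposite sign. Each step loses at most the root of [A x + B], where [1 / R] has a
    pole. *)
Lemma carlitz_map_moebius (c : nat -> F) n : c 0%N != 0 ->
  exists A B C D, A * D - B * C != 0 /\
    (#|F| <= #|moebius_agree (carlitz_map c n) A B C D| + n)%N.
Proof.
move=> c0; elim: n => [|n [A [B [C [D [det leF]]]]]].
  exists (c 0%N), (c 1%N), 0, 1; rewrite mulr1 mulr0 subr0; split=> //.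
  rewrite addn0 leq_eqVlt -cardsT; apply/orP; left; apply/eqP/eq_card => x.
  by rewrite !inE mul0r add0r oner_eq0 divr1 /= eqxx.
exists (C + c n.+2 * A), (D + c n.+2 * B), A, B; split.
  by rewrite -oppr_eq0; congr (_ != 0): det; ring.
apply: leq_trans leF _; rewrite addnS -addSn leq_add2r -addn1.
set G := moebius_agree _ _ _ _ _; set G' := moebius_agree _ _ _ _ _.
rewrite -(cardsID [set x | A * x + B == 0] G) addnC; apply: leq_add.
  apply/subset_leq_card/subsetP => x; rewrite !inE.
  case/and3P => AB CD /eqP /= ->; rewrite AB /=.
  by apply/eqP; field; apply/andP.
apply: leq_trans (subset_leq_card (subsetIr _ _)) _.
apply/card_le1_eqP => x y; rewrite !inE => /eqP Ex /eqP Ey.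
have A0 : A != 0.
  apply: contraNneq det => A0; move: Ex; rewrite A0 !mul0r add0r => ->.
  by rewrite mul0r subrr.
by apply: (mulfI A0); apply: (addIr B); rewrite Ex Ey.
Qed.

End Moebius.

(** * Degree bounds and independence of polynomials *)

Lemma leq_size_mul (F : fieldType) (p q : {poly F}) (a b : nat) :
  (size p <= a.+1)%N -> (size q <= b.+1)%N -> (size (p * q)%R <= (a + b).+1)%N.
Proof. by move=> pa qb; apply: leq_trans (size_polyMleq _ _) _; lia. Qed.

Lemma leq_size_exp (F : fieldType) (p : {poly F}) (a n : nat) :
  (size p <= a.+1)%N -> (size (p ^+ n)%R <= (a * n).+1)%N.
Proof.
move=> pa; elim: n => [|n IHn]; first by rewrite size_poly1.
by rewrite exprS mulnS; apply: leq_size_mul.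
Qed.

(* The Taylor coefficients at [x], as polynomials in [x], gain degree at most 2
   with each order of derivation. *)
Definition graded_deg (F : fieldType) (d : nat) (P : {poly {poly F}}) :=
  forall k, (size (P`_k)%R <= (d + 2 * k).+1)%N.

Lemma graded_degM (F : fieldType) (d e : nat) (P Q : {poly {poly F}}) :
  graded_deg d P -> graded_deg e Q -> graded_deg (d + e) (P * Q).
Proof.
move=> dP eQ k; rewrite coefM.
apply: (big_ind (fun p : {poly F} => size p <= (d + e + 2 * k).+1)%N).
- by rewrite size_poly0.
- by move=> p q hp hq; apply: leq_trans (size_polyD _ _) _; rewrite geq_max hp.
move=> i _; apply: leq_trans (leq_size_mul (dP i) (eQ _)) _.
by have := ltn_ord i; lia.
Qed.

Lemma graded_degX (F : fieldType) (P : {poly {poly F}}) n :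
  graded_deg 0 P -> graded_deg 0 (P ^+ n).
Proof.
move=> dP; elim: n => [|n IHn]; last by rewrite exprS; apply: (@graded_degM _ 0 0).
by move=> k; rewrite expr0 coef1; case: k => [|k]; rewrite ?size_poly1 ?size_poly0.
Qed.

Lemma graded_degC (F : fieldType) (p : {poly F}) d :
  (size p <= d.+1)%N -> graded_deg d p%:P.
Proof.
move=> dp k; rewrite coefC; case: eqP => [->|]; last by rewrite size_poly0.
by rewrite muln0 addn0.
Qed.

Lemma graded_deg_lin (F : fieldType) (p : {poly F}) :
  (size p <= 3)%N -> graded_deg 0 (1 + p%:P * 'X).
Proof.
move=> dp [|[|k]]; rewrite coefD coefCM coefX coef1 /= ?mulr0 ?addr0 ?add0r.
- by rewrite size_poly1.
- by rewrite mulr1.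
by rewrite size_poly0.
Qed.

(** Modulo [P] only the term [i = 0] survives, so [P] divides [a 0], which is smaller and hence
    zero; then divide by [P] and repeat. *)
Lemma coprime_power_free (F : fieldType) (P : {poly F}) n (a h : nat -> {poly F}) :
  (forall i, (size (a i) < size P)%N) -> (forall i, coprimep P (h i)) ->
  \sum_(i < n) a i * h i * P ^+ i = 0 -> forall i, (i < n)%N -> a i = 0.
Proof.
elim: n a h => [|n IHn] a h sz cop //.
rewrite big_ord_recl expr0 mulr1 /bump /=.
under eq_bigr do rewrite /bump /= add1n exprSr mulrA.
rewrite -big_distrl /= => eq0.
have P0 : P != 0 by rewrite -size_poly_gt0 (leq_ltn_trans _ (sz 0%N)).
have a0 : a 0%N = 0.
  apply/eqP; apply: contraTT (sz 0%N) => a0; rewrite -leqNgt dvdp_leq //.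
  rewrite -(Gauss_dvdpl _ (cop 0%N)).
  move/eqP: eq0; rewrite addr_eq0 => /eqP ->.
  by rewrite dvdpNr dvdp_mull.
move: eq0; rewrite a0 mul0r add0r => /eqP; rewrite mulf_eq0 (negPf P0) orbF.
move/eqP=> eq0 [|i] // lti.
by apply: (IHn (fun i => a i.+1) (fun i => h i.+1)) => // j; rewrite ?sz ?cop.
Qed.

Lemma coprimep_affine (F : fieldType) (A B : F) (p : {poly F}) :
  A != 0 -> ~~ root p (- B / A) -> coprimep (A *: 'X + B%:P) p.
Proof.
move=> A0 rp; have -> : A *: 'X + B%:P = A *: ('X - (- B / A)%:P).
  by rewrite scalerBr -[A *: _%:P]mul_polyC -polyCM mulrCA divff // mulr1 polyCN opprK.
by rewrite coprimepZl // coprimep_sym coprimep_XsubC.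
Qed.

(** Counts the linear conditions imposed in [leq_card_stepanov]; adding [M] on the left avoids a
    subtraction. *)
Lemma sum_arith (m M : nat) :
  (\sum_(k < M) (m + 2 * k) + M = m * M + M * M)%N.
Proof.
elim: M => [|M IHM]; first by rewrite big_ord0 !muln0.
rewrite big_ord_recr /=; move: IHM; set S := (\sum_(_ < _) _)%N.
by rewrite !mulnS !mulSn; lia.
Qed.

Lemma expf_card_pred (F : finFieldType) (x : F) : x != 0 -> x ^+ #|F|.-1 = 1.
Proof.
move=> x0; apply: (mulfI x0); rewrite mulr1 -exprS prednK ?expf_card //.
exact: ltnW (card_finNzRing_gt1 F).
Qed.

Lemma size_affine (F : fieldType) (U V : F) : (size (U *: 'X + V%:P : {poly F})%R <= 2)%N.
Proof.
apply: leq_trans (size_polyD _ _) _; rewrite geq_max.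
rewrite (leq_trans (size_scale_leq _ _)) ?size_polyX //.
by rewrite (leq_trans (size_polyC_leq1 _)).
Qed.

(** * Stepanov's method for [(A x + B)^m x^(e m) = c (C x + D)^m] *)

Section Stepanov.
Variables (F : finFieldType) (l m e J : nat) (A B C D c : F).
Hypotheses (lm : #|F|.-1 = (l * m)%N) (m_gt0 : (0 < m)%N) (l_gt0 : (0 < l)%N).
Hypotheses (A0 : A != 0) (B0 : B != 0) (det : A * D - B * C != 0) (c0 : c != 0).

Let LA : {poly F} := A *: 'X + B%:P.
Let LC : {poly F} := C *: 'X + D%:P.
(* [ex i] is [e * m * i] reduced modulo [#|F|.-1]. *)
Let ex (i : nat) := (m * ((e * i) %% l))%N.

Definition stepanov_basis (i s : nat) : {poly F} :=
  'X^s * ('X^(ex i) * LC ^+ (m * (J - i))) * (LA ^+ m) ^+ i.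

(* At a root [x] of the equation this is [stepanov_basis i s] evaluated at
   [x + x (A x + B) (C x + D) Z], up to a nonzero factor independent of [i] and
   [s]; [x] is the inner variable and [Z] the outer one. *)
Definition stepanov_local (i s : nat) : {poly {poly F}} :=
  (c ^+ i *: 'X^s)%:P * (1 + (LA * LC)%:P * 'X) ^+ (s + ex i) *
  (1 + (C *: ('X * LA))%:P * 'X) ^+ (m * (J - i)) *
  (1 + (A *: ('X * LC))%:P * 'X) ^+ (m * i).

(** The degree is at most [(m - 1) + m (l - 1) + m J] with [l m = q - 1]; the reduction in [ex i]
    gives the middle term. *)
Lemma size_stepanov_basis i s : (i <= J)%N -> (s < m)%N ->
  (size (stepanov_basis i s) < #|F| + m * J)%N.
Proof.
move=> iJ sm; have sXn k : (size ('X^k : {poly F})%R <= k.+1)%N by rewrite size_polyXn.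
have sL U V k : (size ((U *: 'X + V%:P : {poly F}) ^+ k)%R <= k.+1)%N.
  by have := leq_size_exp k (size_affine U V); rewrite mul1n.
rewrite /stepanov_basis -exprM.
apply: leq_ltn_trans (leq_size_mul (leq_size_mul (sXn _)
  (leq_size_mul (sXn _) (sL _ _ _))) (sL _ _ _)) _.
have := ltn_pmod (e * i) l_gt0; rewrite /ex.
have F0 : (0 < #|F|)%N by exact: ltnW (card_finNzRing_gt1 F).
rewrite -(prednK F0) lm.
by set z := ((e * i) %% l)%N => zl; nia.
Qed.

(** Only [X^s] contributes: the other factors are powers of [1 + p Z] with [p] of degree at most 2,
    whatever their exponents. *)
Lemma graded_stepanov_local i s : graded_deg s (stepanov_local i s).
Proof.
have size3 (p q : {poly F}) : (size p <= 2)%N -> (size q <= 2)%N -> (size (p * q)%R <= 3)%N.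
  by move=> hp hq; apply: (leq_size_mul hp hq).
have sX : (size ('X : {poly F})%R <= 2)%N by rewrite size_polyX.
have ss d k (p : {poly F}) : (size p <= d)%N -> (size (k *: p)%R <= d)%N.
  by move=> hp; apply: leq_trans (size_scale_leq _ _) hp.
rewrite /stepanov_local -[s in graded_deg s]addn0 -[(s + 0)%N]addn0 -[(s + 0 + 0)%N]addn0.
do !apply: graded_degM; try apply: graded_degX; try apply: graded_deg_lin.
- by apply: graded_degC; apply: ss; rewrite size_polyXn.
- by apply: size3; apply: size_affine.
- by apply: ss; apply: size3 => //; apply: size_affine.
- by apply: ss; apply: size3 => //; apply: size_affine.
Qed.

(** The increment is a multiple of [x], [A x + B] and [C x + D], so each of [X], [LA], [LC] takes
    its value at [x] times some [1 + p Z]. *)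
Lemma stepanov_localE i s x : (i <= J)%N ->
  x != 0 -> A * x + B != 0 -> C * x + D != 0 ->
  (A * x + B) ^+ m * x ^+ (e * m) = c * (C * x + D) ^+ m ->
  stepanov_basis i s \Po (x%:P + (x * (A * x + B) * (C * x + D)) *: 'X) =
  (C * x + D) ^+ (m * J) *: map_poly (horner_eval x) (stepanov_local i s).
Proof.
move=> iJ x0 ax cx eqx; set u := x * _ * _.
rewrite /stepanov_basis /stepanov_local -exprM.
have evA : map_poly (horner_eval x) (1 + (LA * LC)%:P * 'X) =
    1 + ((A * x + B) * (C * x + D)) *: 'X.
  by rewrite rmorphD rmorph1 rmorphM /= map_polyC map_polyX /= /horner_eval !hornerE mul_polyC.
have evB U V : map_poly (horner_eval x) (1 + (U *: ('X * V))%:P * 'X) =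
    1 + (U * (x * V.[x])) *: 'X.
  by rewrite rmorphD rmorph1 rmorphM /= map_polyC map_polyX /= /horner_eval !hornerE mul_polyC.
have hLA : LA.[x] = A * x + B by rewrite !hornerE.
have hLC : LC.[x] = C * x + D by rewrite !hornerE.
move: evA (evB C LA) (evB A LC).
set P1 := 1 + _ * 'X; set P2 := 1 + _ * 'X; set P3 := 1 + _ * 'X => e1 e2 e3.
rewrite !rmorphM !rmorphXn /= e1 e2 e3 hLA hLC comp_polyX map_polyC /= /horner_eval.
rewrite hornerZ hornerXn.
have pX : x%:P + u *: 'X = x *: (1 + ((A * x + B) * (C * x + D)) *: 'X) :> {poly F}.
  by rewrite -!mul_polyC /u !polyCM; ring.
have pA : LA \Po (x%:P + u *: 'X) = (A * x + B) *: (1 + (A * (x * (C * x + D))) *: 'X).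
  by rewrite comp_polyD comp_polyZ comp_polyX comp_polyC /u -!mul_polyC !polyCM polyCD polyCM; ring.
have pC : LC \Po (x%:P + u *: 'X) = (C * x + D) *: (1 + (C * (x * (A * x + B))) *: 'X).
  by rewrite comp_polyD comp_polyZ comp_polyX comp_polyC /u -!mul_polyC !polyCM !polyCD !polyCM; ring.
rewrite pA pC pX -!mulrA mul_polyC !exprZn -!(scalerAl, scalerAr) !scalerA.
set PX := (1 + _ *: 'X); set PC := (1 + _ *: 'X); set PA := (1 + _ *: 'X).
(* The [i]-th power of the equation turns the values at [x] into [(C x + D)^(m J)] times the [c^i]
   that [stepanov_local] carries. *)
have key : x ^+ ex i * ((C * x + D) ^+ (m * (J - i)) * (A * x + B) ^+ (m * i)) =
    (C * x + D) ^+ (m * J) * c ^+ i.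
  have -> : x ^+ ex i = x ^+ (e * m * i).
    rewrite /ex exprM expr_mod -?exprM -?lm ?expf_card_pred //.
    by congr (_ ^+ _); rewrite mulnCA mulnA.
    by rewrite mulnC -lm expf_card_pred.
  have -> : (m * J = m * (J - i) + m * i)%N by rewrite -mulnDr subnK.
  rewrite exprD mulrCA -!mulrA; congr (_ * _).
  rewrite (exprM _ (e * m)) !(exprM _ m i) -exprMn mulrC eqx exprMn.
  by rewrite mulrC.
rewrite exprD -!mulrA key; congr (_ *: _).
by rewrite mulrCA (mulrC (x ^+ s)).
Qed.

(** Grouped by [i], the sum is an expansion in powers of [LA ^+ m] with digits of degree below [m].
    The root [- B / A] of [LA] is neither [0] nor a root of [LC], so [coprime_power_free]
    applies. *)
Lemma stepanov_free (v : 'I_J.+1 * 'I_m -> F) :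
  \sum_p v p *: stepanov_basis p.1 p.2 = 0 -> forall p, v p = 0.
Proof.
pose w (i s : nat) : F :=
  if (insub i, insub s) is (Some j, Some t) then v (j, t) else 0.
have wE (i : 'I_J.+1) (s : 'I_m) : w i s = v (i, s) by rewrite /w !valK.
pose a (i : nat) : {poly F} := \poly_(s < m) w i s.
pose h (i : nat) := 'X^(ex i) * LC ^+ (m * (J - i)).
have szL : size LA = 2.
  by rewrite size_polyDl size_scale ?size_polyX // size_polyC; case: (B != 0).
have szP : size (LA ^+ m) = m.+1.
  rewrite -[LHS]prednK ?size_exp ?szL ?mul1n // size_poly_gt0 expf_neq0 //.
  by rewrite -size_poly_gt0 szL.
have cop i : coprimep (LA ^+ m) (h i).
  rewrite coprimep_expl // coprimepMr !coprimep_expr //.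
    apply: coprimep_affine => //; rewrite rootE hornerD hornerZ hornerX hornerC.
    apply: contraNneq det => eq0.
    have -> : A * D - B * C = A * (C * (- B / A) + D) by field.
    by rewrite eq0 mulr0.
  apply: coprimep_affine => //.
  by rewrite rootE hornerX mulf_neq0 ?invr_eq0 ?oppr_eq0.
move=> eq0 [i s]; rewrite -wE.
have : a i = 0.
  apply: (@coprime_power_free _ (LA ^+ m) J.+1 a h) => //; last first.
  - rewrite -[RHS]eq0.
    transitivity (\sum_(k < J.+1) \sum_(t < m) v (k, t) *: stepanov_basis k t).
      apply: eq_bigr => k _; rewrite /a poly_def !big_distrl.
      by apply: eq_bigr => t _; rewrite /= wE /stepanov_basis -!scalerAl.
    by rewrite pair_bigA; apply: eq_bigr => -[].
  - by move=> k; rewrite szP ltnS size_poly.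
by move/(congr1 (fun p : {poly F} => p`_s)); rewrite coef_poly ltn_ord coef0.
Qed.

(** Making the first [M] Taylor coefficients vanish identically in [x] costs [m M + M (M - 1)]
    linear conditions, fewer than the [m (J + 1)] unknowns. *)
Lemma leq_card_stepanov (T : {set F}) (M : nat) :
  (m * M + M * M < m * J.+1 + M)%N ->
  (forall x, x \in T -> [/\ x != 0, A * x + B != 0, C * x + D != 0 &
     (A * x + B) ^+ m * x ^+ (e * m) = c * (C * x + D) ^+ m]) ->
  (#|T| * M < #|F| + m * J)%N.
Proof.
move=> leN inT.
(* As [s < m], the Taylor coefficient of order [k] has size at most [m + 2 k]. *)
pose col : finType := {k : 'I_M & 'I_(m + 2 * k)}.
pose mon (p : 'I_J.+1 * 'I_m) (q : col) : F := ((stepanov_local p.1 p.2)`_(tag q))`_(tagged q).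
have ltN : (#|col| < #|{: 'I_J.+1 * 'I_m}|)%N.
  rewrite card_prod !card_ord card_tagged sumnE big_map big_enum /=.
  under eq_bigr do rewrite card_ord.
  by have := sum_arith m M; rewrite (mulnC J.+1); set S := (\sum_(_ < _) _)%N; lia.
have [v [[p0 vp0] v0]] := exists_lin_dep mon ltN.
(* By the choice of [v], [P] vanishes to order [M] at every point of [T]. *)
pose P := \sum_p v p *: stepanov_basis p.1 p.2.
have P0 : P != 0 by apply: contraNneq vp0 => /stepanov_free ->.
have szP : (size P < #|F| + m * J)%N.
  apply: (big_ind (fun p : {poly F} => size p < #|F| + m * J)%N).
  - by rewrite size_poly0 addn_gt0 (ltnW (card_finNzRing_gt1 F)).
  - by move=> p q hp hq; rewrite (leq_ltn_trans (size_polyD _ _)) // gtn_max hp.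
  move=> [i s] _; apply: leq_ltn_trans (size_scale_leq _ _) _.
  by apply: size_stepanov_basis; rewrite // -ltnS.
apply: leq_ltn_trans (ltnW (leq_mul_card_roots P0 _)) szP => x xT.
have [x0 ax cx eqx] := inT x xT.
pose u := x * (A * x + B) * (C * x + D).
have u0 : u != 0 by rewrite !mulf_neq0.
pose K := \sum_p (v p)%:P *: stepanov_local p.1 p.2.
have KE k : (k < M)%N -> K`_k = 0.
  move=> kM; apply/polyP => d; rewrite coef0 !coef_sum.
  under eq_bigr do rewrite coefZ coefCM.
  have [ltd|led] := ltnP d (m + 2 * k).
    exact: (v0 (@Tagged _ (Ordinal kM) (fun k : 'I_M => 'I_(m + 2 * k)) (Ordinal ltd))).
  apply: big1 => -[i s] _ /=; rewrite [X in _ * X]nth_default ?mulr0 //.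
  apply: leq_trans (graded_stepanov_local i s k) _; apply: leq_trans led.
  by rewrite -addSn leq_add2r.
have PK : P \Po (x%:P + u *: 'X) = (C * x + D) ^+ (m * J) *: map_poly (horner_eval x) K.
  rewrite raddf_sum rmorph_sum /= scaler_sumr; apply: eq_bigr => -[i s] _ /=.
  rewrite comp_polyZ (stepanov_localE s _ x0 ax cx eqx); last by rewrite -ltnS.
  apply/polyP => k; rewrite !(coefZ, coef_map_id0) /horner_eval ?horner0 //.
  by rewrite hornerM hornerC mulrCA.
have : 'X^M %| P \Po (x%:P + u *: 'X).
  rewrite PK dvdpZr ?expf_neq0 // -[map_poly _ K](poly_take_drop M).
  rewrite (_ : take_poly M _ = 0) ?add0r ?dvdp_mull //.
  apply/polyP => k; rewrite coef_take_poly coef0; case: ifP => // kM.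
  by rewrite coef_map_id0 ?KE // /horner_eval horner0.
(* Undo the substitution: [Z] becomes [(X - x) / u]. *)
case/dvdpP => q /(congr1 (fun p => p \Po (u^-1 *: ('X - x%:P)))).
rewrite -comp_polyA comp_polyD comp_polyC comp_polyZ comp_polyX scalerA divff //.
rewrite scale1r addrC subrK comp_polyXr => ->.
by rewrite comp_polyM comp_Xn_poly exprZn dvdp_mull // dvdpZr // expf_neq0 ?invr_eq0.
Qed.

End Stepanov.

(** * Counting agreements with a Moebius map *)

Lemma card_unity_roots (F : finFieldType) n :
  (0 < n)%N -> (#|[set x : F | x ^+ n == 1%R]| <= n)%N.
Proof.
move=> n_gt0; rewrite cardE; apply: max_unity_roots => //; last exact: enum_uniq.
by apply/allP => x; rewrite mem_enum inE unity_rootE.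
Qed.

Lemma exists_nat_sqrt n : exists M, (M * M <= n < M.+1 * M.+1)%N.
Proof.
elim: n => [|n [M /andP[leM ltM]]]; first by exists 0%N.
by have [lt|ge] := ltnP n.+1 (M.+1 * M.+1); [exists M | exists M.+1]; nia.
Qed.

Section Agreement.
Variables (F : finFieldType) (l m r : nat) (g : F -> F) (A B C D : F).
Hypotheses (lm : #|F|.-1 = (l * m)%N) (l_gt0 : (0 < l)%N) (m_gt0 : (0 < m)%N).
Hypotheses (g_inj : injective g) (g0 : g 0 = 0).
(** [g_hom] reflects that [x] and [t x] lie in one coset, [g_pow] that the [a_i] share their [m]-th
    power; [BC] and [AD] exclude [R x = a x] and [R x = c / x]. *)
Hypothesis g_hom : forall t x, x != 0 -> t ^+ m = 1 -> g (t * x) = t ^+ r * g x.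
Hypothesis g_pow : exists2 c, c != 0 & forall x, x != 0 -> g x ^+ m = c * x ^+ (r * m).
Hypotheses (det : A * D - B * C != 0).
Hypotheses (BC : (B != 0) || (C != 0)) (AD : (A != 0) || (D != 0)).

Let G := moebius_agree g A B C D :\ 0.

(** The numerator cannot vanish, since [g x = 0 = g 0] would force [x = 0]. *)
Lemma agreeP x : x \in G ->
  [/\ x != 0, A * x + B != 0, C * x + D != 0 & g x = (A * x + B) / (C * x + D)].
Proof.
rewrite !inE => /and3P[x0 cx /eqP gx]; split=> //.
apply: contraNneq x0 => ax; apply/eqP/g_inj.
by rewrite gx ax mul0r g0.
Qed.

(** [R (t y) = t^r R y] is quadratic in [y]. If [t^r <> 1], its extreme coefficients both vanish
    only when [A C = B D = 0], which [det], [BC] and [AD] forbid; if [t^r = 1], then [g (t y) = g y]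
    contradicts injectivity. *)
Lemma card_agree_shift t : t ^+ m = 1 -> t != 1 ->
  (#|[set y in G | (t * y)%R \in G]| <= 2)%N.
Proof.
move=> tm t1; set S := [set y in G | _].
have t0 : t != 0.
  by apply: contraTneq (oner_neq0 F) => t0; rewrite -tm t0 expr0n eqn0Ngt m_gt0 eqxx.
have [tr1|tr1] := eqVneq (t ^+ r) 1.
  rewrite (_ : S = set0) ?cards0 //; apply/setP => y; rewrite inE [RHS]inE.
  apply/negP => /andP[/agreeP[y0 _ _ _] _].
  have := g_hom y0 tm; rewrite tr1 mul1r => /g_inj /eqP.
  by rewrite -subr_eq0 -{2}[y]mul1r -mulrBl mulf_eq0 subr_eq0 (negPf t1) (negPf y0).
pose p : {poly F} := (A * C * t * (t ^+ r - 1)) *: 'X^2 +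
  ((t ^+ r * (A * D + B * C * t) - (A * D * t + B * C)) *: 'X + (B * D * (t ^+ r - 1))%:P).
have p0 : p != 0.
  have tr0 : t ^+ r - 1 != 0 by rewrite subr_eq0.
  apply: contraNneq det => eq0.
  have /eqP : p`_2 = 0 by rewrite eq0 coef0.
  have /eqP : p`_0 = 0 by rewrite eq0 coef0.
  rewrite !coefD !coefZ !coefXn !coefX !coefC /= !mulr0 !addr0 !add0r mulr1.
  rewrite !mulf_eq0 (negPf tr0) (negPf t0) !orbF.
  case/orP=> /eqP E1 /orP[] /eqP E2; move: BC AD; rewrite E1 E2 ?eqxx ?orbF ?orFb.
  - by rewrite !mul0r subrr.
  - by [].
  - by [].
  - by rewrite !mulr0 subrr.
have szp : (size p <= 3)%N.
  apply: leq_trans (size_polyD _ _) _; rewrite geq_max; apply/andP; split.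
    by apply: leq_trans (size_scale_leq _ _) _; rewrite size_polyXn.
  exact: leq_trans (size_affine _ _) _.
rewrite cardE -ltnS; apply: leq_trans szp; apply: max_poly_roots => //; last exact: enum_uniq.
apply/allP => y; rewrite mem_enum inE => /andP[/agreeP[y0 _ cy gy] /agreeP[_ _ cty]].
rewrite (g_hom y0 tm) gy => /eqP.
rewrite mulrA eqr_div // => /eqP eqy.
rewrite rootE !(hornerD, hornerZ, hornerXn, hornerX, hornerC).
by apply/eqP; move/eqP: eqy; rewrite -subr_eq0 => /eqP eqy; rewrite -[RHS]eqy; ring.
Qed.

(** The map [x ^+ m] splits [G] into at most [l] classes. After Cauchy-Schwarz it remains to count
    pairs [y], [t y] in [G] with [t^m = 1]: [t = 1] gives at most [#|G|], and each of the at most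
    [m - 1] others at most 2. *)
Lemma sqr_card_agree : (#|G| ^ 2 <= l * (#|G| + m.-1 * 2))%N.
Proof.
pose Dl := [set c : F | c ^+ l == 1].
pose n c := #|[set x in G | x ^+ m == c]|.
have inDl x : x \in G -> x ^+ m \in Dl.
  by case/agreeP=> x0 _ _ _; rewrite inE -exprM mulnC -lm expf_card_pred.
have sumG (h : F -> nat) : (\sum_(x in G) h (x ^+ m)%R = \sum_(c in Dl) n c * h c)%N.
  rewrite (partition_big (fun x => x ^+ m) (mem Dl)) //=; apply: eq_bigr => c _.
  rewrite -sum_nat_const; apply: eq_big => [x|x /andP[_ /eqP -> //]].
  by rewrite inE.
have cardG : #|G| = (\sum_(c in Dl) n c)%N.
  by rewrite -sum1_card (sumG (fun=> 1)%N); apply: eq_bigr => c _; rewrite muln1.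
rewrite {1}cardG; apply: leq_trans (leq_sqr_sum _ _) _.
apply: leq_mul; first exact: card_unity_roots.
under eq_bigr do rewrite expnS expn1.
rewrite -(sumG n).
have sum_bool (X : {set F}) (P : pred F) : (\sum_(t in X) P t = #|[set t in X | P t]|)%N.
  rewrite -sum1_card; under [RHS]eq_bigl do rewrite inE.
  by rewrite big_mkcondr; apply: eq_bigr => t _; case: (P t).
pose U := [set t : F | t ^+ m == 1].
have U1 : 1 \in U by rewrite inE expr1n.
apply: (@leq_trans (\sum_(y in G) \sum_(t in U) ((t * y)%R \in G))).
  apply: leq_sum => y /agreeP[y0 _ _ _].
  rewrite (sum_bool U (fun t => t * y \in G)) /n.
  rewrite -(card_imset _ (mulIf (invr_neq0 y0))).
  apply/subset_leq_card/subsetP => _ /imsetP[x + ->]; rewrite !inE.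
  case/andP=> xG /eqP xy.
  by rewrite exprMn exprVn xy divff ?expf_neq0 // eqxx mulfVK.
rewrite exchange_big /= (big_setD1 1) //=; apply: leq_add.
  by rewrite -sum1_card; apply: leq_sum => y _; apply: leq_b1.
apply: (@leq_trans (\sum_(t in U :\ 1) 2)).
  apply: leq_sum => t; rewrite !inE => /andP[t1 /eqP tm].
  by rewrite (sum_bool G (fun y => t * y \in G)) card_agree_shift.
rewrite sum_nat_const leq_mul2r /= -ltnS prednK //.
by have := card_unity_roots F m_gt0; rewrite -/U (cardsD1 1) U1.
Qed.

Lemma agree_stepanov M : (0 < M)%N ->
  (#|G| * M + M < #|F| + m * M + M * M)%N.
Proof.
move=> M_gt0; have [c c0 gc] := g_pow.
(* The largest [J] with [m J <= m M + M^2 - M], so that [m (J + 1)] exceeds the number of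
   conditions. *)
pose J := ((m * M + M * M - M) %/ m)%N.
have leMM : (M <= M * M)%N by rewrite leq_pmulr.
have leJ : (m * J + M <= m * M + M * M)%N.
  by have := leq_divM (m * M + M * M - M) m; rewrite -/J; lia.
have ltJ : (m * M + M * M < m * J.+1 + M)%N.
  by have := ltn_ceil (m * M + M * M - M) m_gt0; rewrite -/J mulnC; lia.
suff lt : (#|G| * M < #|F| + m * J)%N by lia.
have agreeE x : x \in G ->
    (A * x + B) ^+ m = c * x ^+ (r * m) * (C * x + D) ^+ m.
  by case/agreeP=> x0 _ cx gx; rewrite -gc // gx expr_div_n divfK ?expf_neq0.
(* A nonnegative power inverts [x^(r m)]; this gives [e = r (q - 2)]. *)
have xr (x : F) : x != 0 -> x ^+ (r * #|F|.-2 * m) * x ^+ (r * m) = 1.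
  move=> x0; rewrite mulnAC -exprD -mulnSr prednK.
    by rewrite mulnC exprM expf_card_pred // expr1n.
  by rewrite lm muln_gt0 l_gt0.
have [/andP[A0 B0]|nAB] := boolP ((A != 0) && (B != 0)).
  apply: (@leq_card_stepanov F l m (r * #|F|.-2)%N J A B C D c) => // x xG.
  have [x0 ax cx _] := agreeP xG; split=> //.
  by rewrite agreeE // mulrAC -(mulrA c) (mulrC (x ^+ _)) xr // mulr1.
(* Otherwise apply the same bound to the reciprocal of the equation. *)
have [C0 D0] : C != 0 /\ D != 0.
  move: det BC AD nAB; have [->|] := eqVneq C 0; have [->|] := eqVneq D 0;
  have [->|] := eqVneq A 0; have [->|] := eqVneq B 0;
  by rewrite ?(mul0r, mulr0, subrr, eqxx).
apply: (@leq_card_stepanov F l m r J C D A B c^-1) => //.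
- by rewrite -oppr_eq0; congr (_ != 0): det; ring.
- by rewrite invr_eq0.
move=> x xG; have [x0 ax cx _] := agreeP xG; split=> //.
rewrite agreeE //.
by rewrite mulrC !mulrA mulVf // mul1r.
Qed.

Lemma card_agree_le (R : rcfType) : #|moebius_agree g A B C D|%:R <= 3 * Num.sqrt #|F|%:R :> R.
Proof.
have q_gt1 := card_finNzRing_gt1 F.
set Q : R := Num.sqrt _.
have QQ : Q * Q = #|F|%:R by rewrite -expr2 sqr_sqrtr ?ler0n.
have Q_ge0 : 0 <= Q by apply: sqrtr_ge0.
have qlm : #|F|%:R = l%:R * m%:R + 1 :> R.
  by rewrite -natrM -lm natr1 prednK // ltnW.
have Q_ge1 : 1 <= Q.
  have : (1 : R) <= #|F|%:R by rewrite ler1n ltnW.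
  rewrite -QQ; nra.
(* The point [0], absent from [G], may be one more agreement. *)
suff leG : #|G|%:R + 1 <= 3 * Q.
  apply: le_trans leG; rewrite natr1 ler_nat -[X in (_ <= X)%N]add1n.
  by rewrite (cardsD1 0) leq_add2r leq_b1.
have l_ge1 : 1 <= l%:R :> R by rewrite ler1n.
have m_ge1 : 1 <= m%:R :> R by rewrite ler1n.
have [leQ|ltQ] := lerP l%:R Q.
  have := sqr_card_agree; rewrite -(ler_nat R) natrX natrM natrD natrM.
  rewrite -subn1 natrB // => le2.
  (* With [s = #|G|], [le2] yields [s^2 <= Q s + 2 Q^2], that is [(s - 2 Q) (s + Q) <= 0]. *)
  have : #|G|%:R <= 2 * Q by nra.
  by lra.
have [M /andP[leM ltM]] := exists_nat_sqrt #|F|.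
have M_gt0 : (0 < M)%N by rewrite lt0n; apply: contraTneq ltM => ->; rewrite -leqNgt ltnW.
(* Strictness between integers gains a 1, which absorbs [(Q - M)^2 < 1]: hence
   [Q^2 + M^2 - 1 < 2 Q M]. *)
have := agree_stepanov M_gt0; rewrite -(ler_nat R) -natr1 !natrD !natrM.
move: leM ltM; rewrite -(ler_nat R) -(ltr_nat R) !natrM -QQ -natr1.
set s : R := #|G|%:R => leM ltM st.
have M_ge1 : 1 <= M%:R :> R by rewrite ler1n.
have M_leQ : M%:R <= Q by nra.
have Q_ltM : Q < M%:R + 1 by nra.
have mQ : m%:R < Q by nra.
have : (s + 1) * M%:R < (2 * Q + m%:R) * M%:R by nra.
by rewrite ltr_pM2r; lra.
Qed.

End Agreement.

(** * Cyclotomic cosets and [m]-th roots of unity *)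

Section Cosets.
Variables (F : finFieldType) (xi : F) (l : nat).
Hypotheses (xi_prim : (#|F|.-1).-primitive_root xi) (l_dvd : (l %| #|F|.-1)%N).

Let m := (#|F|.-1 %/ l)%N.
Let lm : #|F|.-1 = (l * m)%N. Proof. by rewrite mulnC divnK. Qed.
Let l_gt0 : (0 < l)%N.
Proof. by have := prim_order_gt0 xi_prim; rewrite lm muln_gt0 => /andP[]. Qed.
Let m_gt0 : (0 < m)%N.
Proof. by have := prim_order_gt0 xi_prim; rewrite lm muln_gt0 => /andP[]. Qed.

(** As [xi ^+ l] has order [m], any exponent [k] can be reduced modulo [m]. *)
Lemma cyclotomic_cosetP (i : nat) (x : F) :
  reflect (exists k, x = xi ^+ (i + k * l)) (x \in cyclotomic_coset xi l i).
Proof.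
apply: (iffP imsetP) => [[y /imsetP[k _ ->] ->]|[k ->]].
  by exists k; rewrite exprD.
have kP : (k %% m < #|F|.-1 %/ l)%N by rewrite ltn_pmod.
exists (xi ^+ ((k %% m) * l)); first by apply/imsetP; exists (Ordinal kP).
rewrite exprD; congr (_ * _); apply/eqP; rewrite (eq_prim_root_expr xi_prim).
by rewrite lm (mulnC l) !(mulnC _ l) -!muln_modr modn_mod.
Qed.

Lemma cyclotomic_coset_cover (x : F) : x != 0 ->
  exists i : 'I_l, x \in cyclotomic_coset xi l i.
Proof.
move=> /expf_card_pred x1; have [k ->] := prim_rootP xi_prim x1.
exists (Ordinal (ltn_pmod k l_gt0)); apply/cyclotomic_cosetP.
by exists (k %/ l)%N; rewrite addnC -divn_eq.
Qed.

(** An [m]-th root of unity is a power of [xi ^+ l]. *)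
Lemma cyclotomic_coset_mull i (t x : F) : t ^+ m = 1 ->
  x \in cyclotomic_coset xi l i -> t * x \in cyclotomic_coset xi l i.
Proof.
move=> tm /cyclotomic_cosetP[k ->]; apply/cyclotomic_cosetP.
have t1 : t ^+ #|F|.-1 = 1 by rewrite lm mulnC exprM tm expr1n.
have [[n ltn] /= tE] := prim_rootP xi_prim t1; move: tm; rewrite tE -exprM {ltn}.
move/eqP; rewrite -(prim_order_dvd xi_prim) lm dvdn_pmul2r // => /dvdnP[h ->].
by exists (h + k)%N; rewrite -exprD mulnDl addnCA.
Qed.

Lemma cyclotomic_coset_expr i (x : F) :
  x \in cyclotomic_coset xi l i -> x ^+ m = xi ^+ (i * m).
Proof.
case/cyclotomic_cosetP=> k ->; rewrite -exprM mulnDl exprD -mulnA -lm.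
by rewrite (mulnC k) (exprM _ _ k) (prim_expr_order xi_prim) expr1n mulr1.
Qed.

End Cosets.

(** * Deduction of the Carlitz rank bound *)

Theorem theorem2 (R : rcfType) (F : finFieldType) (xi : F)
    (xi_prim : (#|F|.-1).-primitive_root xi)
    (l : nat) (l_gt0 : (0 < l)%N) (l_dvd : (l %| #|F|.-1)%N)
    (r : nat) (r_gt0 : (0 < r)%N)
    (a : 'I_l -> F) (a_neq0 : forall i, a i != 0)
    (a_coset : exists j : 'I_l, forall i, a i \in cyclotomic_coset xi l j)
    (f : {poly F}) (f_perm : perm_poly f) (f0 : f.[0] = 0)
    (fE : forall (i : 'I_l) (x : F),
       x \in cyclotomic_coset xi l i -> f.[x] = a i * x ^+ r) :
  #|F|%:R - Num.max (3 * Num.sqrt #|F|%:R)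
              (Num.max (linearity f)%:R (invertibility f)%:R)
    <= (Crk f_perm)%:R :> R.
Proof.
rewrite /Crk; case: ex_minnP => n /existsP[c /and3P[c0 _ /forallP/= eqf]] _.
have [A [B [C [D [det leF]]]]] := carlitz_map_moebius n c0.
have {leF} : (#|F| <= #|moebius_agree (horner f) A B C D| + n)%N.
  apply: leq_trans leF _; rewrite leq_add2r; apply/subset_leq_card/subsetP => x.
  by rewrite !inE (eqP (eqf x)).
rewrite -(ler_nat R) natrD -lerBlDr => leF; rewrite lerBlDl -lerBlDr.
apply: le_trans leF _; rewrite !le_max !ler_nat.
(* Here [R x = (A / D) x], so the linearity bounds the agreement. *)
have [/norP[/negPn/eqP B0 /negPn/eqP C0]|BC] := boolP (~~ ((B != 0) || (C != 0))).
  apply/orP; right; apply/orP; left.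
  have [A0 D0] : A != 0 /\ D != 0.
    by move: det; rewrite B0 mul0r subr0 mulf_eq0 => /norP.
  apply: leq_trans (leq_bigmax_cond (A / D) _); last by rewrite mulf_neq0 ?invr_eq0.
  apply/subset_leq_card/subsetP => x; rewrite !inE B0 C0 mul0r add0r addr0.
  by case/andP=> _ /eqP ->; rewrite mulrAC.
(* Here [R x = (B / C) / x], and [C x + D <> 0] gives [x <> 0], so the invertibility bounds the
   agreement. *)
have [/norP[/negPn/eqP A0 /negPn/eqP D0]|AD] := boolP (~~ ((A != 0) || (D != 0))).
  apply/orP; right; apply/orP; right.
  have [B0 C0] : B != 0 /\ C != 0.
    by move: det; rewrite A0 mul0r sub0r oppr_eq0 mulf_eq0 => /norP.
  apply: leq_trans (leq_bigmax_cond (B / C) _); last by rewrite mulf_neq0 ?invr_eq0.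
  apply/subset_leq_card/subsetP => x; rewrite !inE A0 D0 mul0r add0r addr0.
  rewrite mulf_eq0 => /andP[/norP[_ ->] /eqP ->] /=.
  by rewrite invfM mulrA.
apply/orP; left.
have lm : #|F|.-1 = (l * (#|F|.-1 %/ l))%N by rewrite mulnC divnK.
have m_gt0 : (0 < #|F|.-1 %/ l)%N.
  by have := prim_order_gt0 xi_prim; rewrite {1}lm muln_gt0 => /andP[].
have xi0 : xi != 0.
  apply: contra_eq_neq (prim_expr_order xi_prim) => ->.
  by rewrite expr0n gtn_eqF ?(prim_order_gt0 xi_prim) // eq_sym oner_neq0.
apply: (card_agree_le lm l_gt0 m_gt0 (bij_inj f_perm) f0 (r := r)) => //.
- move=> t x x0 tm; have [i xi_x] := cyclotomic_coset_cover xi_prim l_dvd x0.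
  rewrite (fE i) ?(cyclotomic_coset_mull xi_prim l_dvd tm) // (fE i) //.
  by rewrite exprMn mulrCA.
(* All [a i] have the [m]-th power [xi^(j m)], where [m = (q - 1) / l]. *)
- have [j aj] := a_coset; exists (xi ^+ (j * (#|F|.-1 %/ l))); first exact: expf_neq0.
  move=> x x0; have [i xi_x] := cyclotomic_coset_cover xi_prim l_dvd x0.
  by rewrite (fE i) // exprMn (cyclotomic_coset_expr xi_prim l_dvd (aj i)) -(exprM x).
- exact: negbNE BC.
- exact: negbNE AD.
Qed.
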